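(* Let $\mathcal{G}$ be a strongly connected and weight-balanced digraph on $n\ge 2$ nodes with Laplacian $\mathsf{L}$, let $A_i\in\mathbb{R}^{m\times m}$, $b_i\in\mathbb{R}^m$ for $i\in\{1,\dots,n\}$, put $A=\sum_{i=1}^n A_i$, $b=\sum_{i=1}^n b_i$, and assume that the equation $Ax=b$ has at least one solution $x\in\mathbb{R}^m$. Assume $\mathrm{null}(A)\subseteq\mathrm{null}(A_i)$ for all $i\in\{1,\dots,n\}$. Let $\mathbf{L}=\mathsf{L}\otimes I_m$, $\mathbf{A}=\mathrm{blkdiag}(A_1,\dots,A_n)$, $\mathbf{b}=[b_1;\dots;b_n]$ and $U=\mathbf{1}_n\otimes I_m$. Let $\alpha,\beta>0$ and define $$\bar\gamma=\max\left\{\frac{2}{\lambda_2(\mathsf{L}+\mathsf{L}^\top)}\,\lambda_{\max}\!\left(\frac{\mathbf{Q}_{12}^\top\mathbf{Q}_{12}}{\lambda_2(\mathbf{Q}_{11})}-n\beta\mathbf{A}\mathbf{A}^\top\right),\,0\right\},$$ where $$\mathbf{Q}_{11}=\tfrac12\alpha(\mathbf{L}+\mathbf{L}^\top)+\beta\mathbf{A}^\top UU^\top\mathbf{A},\qquad \mathbf{Q}_{12}=\tfrac12\left(n\beta\mathbf{A}^\top+\alpha\mathbf{L}^\top\mathbf{A}^\top+\beta\mathbf{A}^\top UU^\top\mathbf{A}\mathbf{A}^\top\right).$$ Then, for all $\gamma\in(\bar\gamma,\infty)$, any trajectory $(\mathbf{x}(t),\mathbf{y}(t))\in\mathbb{R}^{mn}\times\mathbb{R}^{mn}$,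 $t\ge0$, of $$\dot{\mathbf{x}}=-\alpha\mathbf{L}\mathbf{x}-n\beta\mathbf{A}^\top\mathbf{y},\qquad \dot{\mathbf{y}}=-\alpha\mathbf{A}\mathbf{L}\mathbf{x}-n\beta\mathbf{A}\mathbf{A}^\top\mathbf{y}-\gamma\mathbf{L}\mathbf{y}$$ with initial condition satisfying $U^\top\mathbf{y}(0)=U^\top(\mathbf{A}\mathbf{x}(0)-\mathbf{b})$ converges exponentially to $(\mathbf{x}^*,\mathbf{0})$, where $\mathbf{x}^*=\mathbf{1}_n\otimes x^*$ and $x^*\in\mathbb{R}^m$ satisfies $Ax^*=b$.
   Context: A weighted digraph $\mathcal{G}=(\mathcal{V},\mathcal{E},\mathsf{A})$ with $|\mathcal{V}|=n$ has adjacency matrix $\mathsf{A}\in\mathbb{R}^{n\times n}$ with $\mathsf{A}_{ij}>0$ if there is an edge from node $i$ to node $j$, and $\mathsf{A}_{ij}=0$ otherwise. The weighted out- and in-degrees of node $i$ are $\sum_{j}\mathsf{A}_{ij}$ and $\sum_{j}\mathsf{A}_{ji}$; $\mathsf{D}^{\mathrm{out}}$ and $\mathsf{D}^{\mathrm{in}}$ are the corresponding diagonal matrices. The graph is weight-balanced if $\mathsf{D}^{\mathrm{out}}=\mathsf{D}^{\mathrm{in}}$, and strongly connected if there is a directed path between any two distinct nodes. The Laplacian is $\mathsf{L}=\mathsf{D}^{\mathrm{in}}-\mathsf{A}$. $\mathbf{1}_n\in\mathbb{R}^n$ is the all-ones vector, $I_m$ the $m\times m$ identity, $\otimes$ the Kronecker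 product, $\mathrm{blkdiag}(A_1,\dots,A_n)\in\mathbb{R}^{mn\times mn}$ the block-diagonal matrix with the given diagonal blocks, and $[b_1;\dots;b_n]\in\mathbb{R}^{mn}$ the stacked vector. $\mathrm{null}(\cdot)$ is the null space, $\lambda_{\max}(\cdot)$ the maximum eigenvalue of a symmetric matrix, and $\lambda_2(\cdot)$ the minimum non-zero eigenvalue of a positive semidefinite matrix (regardless of the multiplicity of the eigenvalue $0$). A trajectory $z(t)$ converges exponentially to $z^*$ if there are constants $C,\mu>0$ with $\|z(t)-z^*\|\le Ce^{-\mu t}$ for all $t\ge 0$. *)

(* Defs.v *)
From mathcomp Require Import all_boot all_order all_algebra.
From mathcomp Require Import mxtens.
From mathcomp Require Import all_classical all_reals all_analysis.

Set Implicit Arguments.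
Unset Strict Implicit.
Unset Printing Implicit Defensive.

Import Order.TTheory GRing.Theory Num.Theory.
Import numFieldNormedType.Exports.

Local Open Scope classical_set_scope.
Local Open Scope ring_scope.

Record wdigraph (R : realType) (n : nat) := WDigraph {
  edge : rel 'I_n;
  adj : 'M[R]_n;
  adj_edge : forall i j, edge i j -> 0 < adj i j;
  adj_nonedge : forall i j, ~~ edge i j -> adj i j = 0
}.

Definition Dout (R : realType) (n : nat) (G : wdigraph R n) : 'M[R]_n :=
  diag_mx (\row_i \sum_j adj G i j).

Definition Din (R : realType) (n : nat) (G : wdigraph R n) : 'M[R]_n :=
  diag_mx (\row_i \sum_j adj G j i).

Definition weight_balanced (R : realType) (n : nat) (G : wdigraph R n) : Prop :=
  Dout G = Din G.

Definition strongly_connected (R : realType) (n : nat) (G : wdigraph R n) : Prop :=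
  forall i j : 'I_n, i != j -> connect (edge G) i j.

Definition laplacian (R : realType) (n : nat) (G : wdigraph R n) : 'M[R]_n :=
  Din G - adj G.

(* R^(mn) is indexed by 'I_(n * m) through [mxtens_index]: the pair (i, k) of a
   block i and a position k in it has index i * m + k, the indexing used by the
   Kronecker product [*t]. *)
Definition blkdiag (R : realType) (n m : nat) (A : 'I_n -> 'M[R]_m) :
    'M[R]_(n * m) :=
  \matrix_(p, q) let: (i, k) := mxtens_unindex p in
                 let: (j, l) := mxtens_unindex q in
                 if i == j then A i k l else 0.

Definition stack (R : realType) (n m : nat) (b : 'I_n -> 'cV[R]_m) :
    'cV[R]_(n * m) :=
  \col_p let: (i, k) := mxtens_unindex p in b i k ord0.

Definition ones (R : realType) (n : nat) : 'cV[R]_n := const_mx 1.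

(* The set of eigenvalues of a matrix is finite, so the supremum (infimum) below
   is the maximum (minimum) as soon as the set is nonempty; it is nonempty
   for symmetric matrices of positive size (nonzero symmetric matrices). *)
Definition lambda_max (R : realType) (k : nat) (M : 'M[R]_k) : R :=
  sup [set a : R | eigenvalue M a].

Definition lambda2 (R : realType) (k : nat) (M : 'M[R]_k) : R :=
  inf [set a : R | eigenvalue M a /\ a != 0].

(* The library norm on matrices is the sup norm. *)
Definition enorm (R : realType) (k : nat) (v : 'cV[R]_k) : R :=
  Num.sqrt (\sum_(i < k) v i ord0 ^+ 2).

Definition converges_exponentially (R : realType) (k : nat)
    (z : R -> 'cV[R]_k) (zstar : 'cV[R]_k) : Prop :=
  exists C mu : R, [/\ 0 < C, 0 < mu &
    forall t : R, 0 <= t -> enorm (z t - zstar) <= C * expR (- (mu * t))].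

(* z is differentiable with derivative v on [0, +oo[. The values of z at negative
   times are irrelevant; at t = 0 only continuity from the right is asked, which
   forces the one-sided derivative there to be v 0 when v is continuous from the
   right at 0, as for a solution of an ODE with continuous right-hand side. *)
Definition has_derivative (R : realType) (k : nat) (z v : R -> 'cV[R]_k) : Prop :=
  {within [set t : R | 0 <= t], continuous z} /\
  (forall t : R, 0 < t -> is_derive t (1 : R) z (v t)).

(* Main.v *)
Require Import Defs.
From mathcomp Require Import all_boot all_order all_algebra.
From mathcomp Require Import mxtens complex.
From mathcomp Require Import all_classical all_reals all_analysis.
From mathcomp Require Import ring lra.

Set Implicit Arguments.
Unset Strict Implicit.
Unset Printing Implicit Defensive.

Import Order.TTheory GRing.Theory Num.Theory.
Import numFieldNormedType.Exports.

Local Open Scope classical_set_scope.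
Local Open Scope ring_scope.

(** Write bA for the block-diagonal matrix of the A_i, bL = L (x) I, and A, b for
    the sums of the A_i and b_i.  Fix a solution xs of A xs = b, put
    e = x - 1 (x) xs and let z = (I - U U^T / n) y be the deviation of y from the
    average of its blocks.  As U^T bL = 0, the quantity U^T (y - bA e) is
    conserved along trajectories, and the initial condition makes it vanish.
    Hence y = z + U U^T bA e / n, so the pair (e, z) determines the trajectory,
    and substituting in the equations gives ([lyapunov_derivative])
      - d/dt (|e|^2 + |z|^2) / 2
         = <e, Q11 e> + 2 <e, Q12 z> + <z, (n beta bA bA^T + gamma bL) z>.

    This form is positive definite in the relevant directions ([dissipation]),
    by completing the square in e ([schur_bound]).
    - The kernel of Q11 is contained in the set of vectors 1 (x) v with A v = 0
      ([Q11_ker]).  Since null(A) is contained in each null(A_i), the component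
      of e along such a vector is a constant of motion; it vanishes when xs is
      the solution of A xs = b for which the average of the blocks of x(0) minus
      xs lies in the range of A^T ([limit_exists]).  Then
      <e, Q11 e> >= lambda2(Q11) |e|^2 for all times.
    - The blocks of z sum to zero, so that
      <z, bL z> >= lambda2(L + L^T) / 2 |z|^2 ([kron_gap]).  The condition on
      gamma is what makes the Schur complement
      n beta bA bA^T + gamma bL - Q12^T Q12 / lambda2(Q11) positive on such z.

    Therefore V = |e|^2 + |z|^2 satisfies V' <= - 2 mu V for some mu > 0, and
    [gronwall] gives the exponential decay of V, hence of e and of
    y = z + U U^T bA e / n.

    The bounds by [lambda_max] and [lambda2] come from the spectral theorem for
    real symmetric matrices, obtained from the unitary diagonalization over the
    complex numbers ([spectral_decomposition]). *)

(** * Euclidean inner product *)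

Section DotProduct.
Variable R : realType.

Definition dot k (u v : 'cV[R]_k) : R := \sum_i u i 0 * v i 0.

Lemma dotE k (u v : 'cV[R]_k) : dot u v = (u^T *m v) 0 0.
Proof. by rewrite mxE; apply: eq_bigr => i _; rewrite mxE. Qed.

Lemma dotC k (u v : 'cV[R]_k) : dot u v = dot v u.
Proof. by apply: eq_bigr => i _; rewrite mulrC. Qed.

Lemma dotDr k (u v w : 'cV[R]_k) : dot u (v + w) = dot u v + dot u w.
Proof. by rewrite !dotE mulmxDr mxE. Qed.

Lemma dotZr k a (u v : 'cV[R]_k) : dot u (a *: v) = a * dot u v.
Proof. by rewrite !dotE -scalemxAr mxE. Qed.

Lemma dotNr k (u v : 'cV[R]_k) : dot u (- v) = - dot u v.
Proof. by rewrite !dotE mulmxN mxE. Qed.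

Lemma dotDl k (u v w : 'cV[R]_k) : dot (v + w) u = dot v u + dot w u.
Proof. by rewrite !(dotC _ u) dotDr. Qed.

Lemma dotZl k a (u v : 'cV[R]_k) : dot (a *: v) u = a * dot v u.
Proof. by rewrite !(dotC _ u) dotZr. Qed.

Lemma dotNl k (u v : 'cV[R]_k) : dot (- v) u = - dot v u.
Proof. by rewrite !(dotC _ u) dotNr. Qed.

Lemma dot0r k (u : 'cV[R]_k) : dot u 0 = 0.
Proof. by rewrite dotE mulmx0 mxE. Qed.

Lemma dot_mulr k l (M : 'M[R]_(k, l)) u v : dot u (M *m v) = dot (M^T *m u) v.
Proof. by rewrite !dotE trmx_mul trmxK mulmxA. Qed.

Lemma dot_ge0 k (u : 'cV[R]_k) : 0 <= dot u u.
Proof. by apply: sumr_ge0 => i _; rewrite -expr2 sqr_ge0. Qed.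

Lemma dot_eq0 k (u : 'cV[R]_k) : dot u u = 0 -> u = 0.
Proof.
move=> u0; apply/colP => i; rewrite mxE; apply/eqP.
have uu_ge0 j : true -> 0 <= u j 0 * u j 0 by rewrite -expr2 sqr_ge0.
have := psumr_eq0P uu_ge0 u0 (i := i) isT.
by move/eqP; rewrite mulf_eq0 orbb.
Qed.

Lemma dot_gt0 k (u : 'cV[R]_k) : u != 0 -> 0 < dot u u.
Proof.
by move=> u0; rewrite lt_def dot_ge0 andbT; apply: contra_neq u0; exact: dot_eq0.
Qed.

Lemma dot_le2D k (u v : 'cV[R]_k) :
  dot (u + v) (u + v) <= 2 * dot u u + 2 * dot v v.
Proof.
have := dot_ge0 (u - v).
rewrite !(dotDl, dotDr, dotNl, dotNr) (dotC v u); lra.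
Qed.

End DotProduct.

Lemma enorm_dot (R : realType) k (v : 'cV[R]_k) : enorm v = Num.sqrt (dot v v).
Proof. by []. Qed.

Lemma dot_col_mx (R : realType) k l (u : 'cV[R]_k) (v : 'cV[R]_l) :
  dot (col_mx u v) (col_mx u v) = dot u u + dot v v.
Proof. by rewrite !dotE tr_col_mx mul_row_col mxE. Qed.

(** * Spectral bounds for symmetric matrices *)

Section Spectral.
Variable R : realType.

(** The diagonalization of M over R enters only through the eigenvalues d and the
    squared moduli s v of the coordinates of a real vector v in a complex
    orthonormal eigenbasis P; packaging just these two families avoids
    constructing a real eigenbasis.  In the last clause, the real and imaginary
    parts of an eigenvector for the eigenvalue 0 both lie in the real kernel. *)
Lemma spectral_decomposition k (M : 'M[R]_k) : M^T = M ->
  exists (d : 'I_k -> R) (s : 'cV[R]_k -> 'I_k -> R),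
  [/\ forall i, eigenvalue M (d i),
      forall v i, 0 <= s v i,
      forall v, dot v v = \sum_i s v i,
      forall v, dot v (M *m v) = \sum_i d i * s v i &
      forall v i, (forall w, M *m w = 0 -> dot w v = 0) -> d i = 0 -> s v i = 0].
Proof.
move=> Msym; pose toC := real_complex R; pose MC := map_mx toC M.
have MCh : MC \is hermsymmx.
  apply: realsym_hermsym.
    apply/is_hermitianmxP; rewrite expr0 scale1r map_mx_id //.
    by rewrite /MC map_trmx Msym.
  by apply/mxOverP => i j; rewrite mxE; apply/complex_realP; exists (M i j).
have /orthomx_spectralP MCE := hermitian_normalmx MCh.
have DR := hermitian_spectral_diag_real MCh.
have Pu := spectral_unitarymx MC.
set P := spectralmx MC in MCE Pu; set D := spectral_diag MC in MCE DR.
have PM : P *m MC = diag_mx D *m P.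
  by rewrite {1}MCE !mulmxA mulmxV ?mul1mx ?unitarymx_unit.
have PVE : invmx P = (map_mx Num.conj P^T) by apply: invmx_unitary.
pose toV (v : 'cV[R]_k) := map_mx toC v.
exists (fun i => complex.Re (D 0 i)).
exists (fun v i => complex.Re (`|(P *m toV v) i 0| ^+ 2)).
have DE i : D 0 i = toC (complex.Re (D 0 i)).
  by rewrite /toC RRe_real //; exact: (mxOverP DR).
have rowPM i : row i P *m MC = D 0 i *: row i P.
  by rewrite -row_mul PM; apply/rowP => j; rewrite mxE mul_diag_mx !mxE.
have rowP0 i : row i P != 0.
  apply/eqP => r0.
  have := congr1 (row i) (mulmxV (unitarymx_unit Pu)).
  rewrite row_mul r0 mul0mx => /rowP/(_ i)/eqP.
  by rewrite !mxE eqxx eq_sym oner_eq0.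
have toVJ v : map_mx Num.conj (toV v)^T = (toV v)^T.
  by apply/matrixP => a b; rewrite !mxE conj_Creal //;
     apply/complex_realP; exists (v b a).
have sE v i : toC (complex.Re (`|(P *m toV v) i 0| ^+ 2)) = `|(P *m toV v) i 0| ^+ 2.
  by rewrite /toC RRe_real // rpredX // normr_real.
have PVP v : map_mx Num.conj (P *m toV v)^T = (toV v)^T *m invmx P.
  by rewrite trmx_mul map_mxM toVJ PVE.
have toC_sum F : toC (\sum_(i < k) F i) = \sum_(i < k) toC (F i).
  exact: (rmorph_sum (real_complex R)).
split.
- move=> i; rewrite eigenvalue_root_char -(fmorph_root (real_complex R)) map_char_poly.
  rewrite -eigenvalue_root_char; apply/eigenvalueP; exists (row i P) => //.
  by rewrite rowPM; congr (_ *: _).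
- by move=> v i; rewrite -ler0c -[X in _ <= X]/(toC _) sE exprn_ge0.
- move=> v; apply: (@complexI R); rewrite -[RHS]/(toC _) toC_sum -[LHS]/(toC _).
  transitivity (((toV v)^T *m toV v) 0 0).
    by rewrite /toV map_trmx -(map_mxM (real_complex R)) mxE dotE.
  rewrite [X in _ *m X](_ : _ = invmx P *m (P *m toV v)); last first.
    by rewrite (mulKmx (unitarymx_unit Pu)).
  rewrite mulmxA -PVP mxE.
  by apply: eq_bigr => i _; rewrite [RHS]sE normCKC !mxE.
- move=> v; apply: (@complexI R); rewrite -[RHS]/(toC _) toC_sum -[LHS]/(toC _).
  transitivity (((toV v)^T *m (MC *m toV v)) 0 0).
    by rewrite /toV map_trmx -!(map_mxM (real_complex R)) mxE dotE.
  rewrite {1}MCE !mulmxA -PVP -!mulmxA mxE.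
  apply: eq_bigr => i _.
  have -> x y : toC (x * y) = toC x * toC y by exact: (rmorphM (real_complex R)).
  rewrite sE -DE.
  by rewrite normCKC mul_diag_mx !mxE mulrCA.
move=> v i vker di0.
have Di0 : D 0 i = 0 by rewrite DE di0 /toC.
(* [f] stands for either of the real and imaginary parts. *)
have Pri (f : R[i] -> R) : f 0 = 0 -> {morph f : x y / x + y} ->
    (forall x a, f (x * toC a) = f x * a) -> f ((P *m toV v) i 0) = 0.
  move=> f0 fD fM; pose w : 'cV[R]_k := \col_j f (P i j).
  have : dot w v = 0.
    apply: vker; apply/colP => j; rewrite !mxE.
    have := rowPM i; rewrite Di0 scale0r => /rowP/(_ j).
    rewrite !mxE => /(congr1 f); rewrite f0 (big_morph f fD f0) => Pf0; rewrite -[RHS]Pf0.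
    apply: eq_bigr => l _; rewrite !mxE fM [RHS]mulrC; congr (_ * _).
    by rewrite -[in LHS]Msym mxE.
  rewrite [X in f X]mxE (big_morph f fD f0) => dwv; rewrite -[RHS]dwv.
  by apply: eq_bigr => l _; rewrite !mxE fM.
have -> : (P *m toV v) i 0 = 0.
  apply/eqP; rewrite eq_complex.
  have toCM x a : x * toC a = Complex (complex.Re x * a) (complex.Im x * a).
    by case: x => u w; rewrite /toC; simpc.
  rewrite !Pri ?eqxx //; try by case=> ? ? [].
    by move=> x a; rewrite toCM.
  by move=> x a; rewrite toCM.
by rewrite normr0 expr0n.
Qed.


Lemma symmetric_eigenvector k (M : 'M[R]_k) a : M^T = M -> eigenvalue M a ->
  exists2 u : 'cV[R]_k, u != 0 & M *m u = a *: u.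
Proof.
move=> Msym /eigenvalueP [w wM w0]; exists w^T; first by rewrite trmx_eq0.
by rewrite -{1}Msym -trmx_mul wM linearZ.
Qed.

(** The eigenvalues are bounded above, so each of them is at most the supremum
    [lambda_max M], and the quadratic form is a combination of eigenvalues with
    nonnegative weights of sum |v|^2. *)
Lemma rayleigh_lambda_max k (M : 'M[R]_k) v : M^T = M ->
  dot v (M *m v) <= lambda_max M * dot v v.
Proof.
move=> Msym; have [d [s [dM s_ge0 sE sM _]]] := spectral_decomposition Msym.
have ubM : has_ubound [set a : R | eigenvalue M a].
  exists (\sum_i `|d i|) => a /= /(symmetric_eigenvector Msym)[u u0 Mu].
  rewrite -(ler_pM2r (dot_gt0 u0)) -dotZr -Mu sM sE mulr_sumr.
  apply: ler_sum => i _; apply: ler_wpM2r => //.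
  by rewrite (bigD1 i) //= (le_trans (ler_norm _)) // lerDl sumr_ge0.
rewrite sM sE mulr_sumr; apply: ler_sum => i _; apply: ler_wpM2r => //.
by rewrite /lambda_max; exact: (ub_le_sup ubM (dM i)).
Qed.

Lemma mulmx_norm_bound k l (M : 'M[R]_(k, l)) :
  exists2 K : R, 0 < K & forall v, dot (M *m v) (M *m v) <= K * dot v v.
Proof.
exists (`|lambda_max (M^T *m M)| + 1) => [|v]; first by rewrite ltr_wpDl.
rewrite dot_mulr mulmxA dotC.
apply: le_trans (rayleigh_lambda_max _ _) _.
  by rewrite trmx_mul trmxK.
apply: ler_wpM2r; first exact: dot_ge0.
by rewrite (le_trans (ler_norm _)) // lerDl.
Qed.

(** A vector v orthogonal to the kernel has no weight on the eigenvalue 0, so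
    only eigenvalues at least [lambda2 M] contribute to its quadratic form.
    Existence of a vector with positive form ensures that M has a nonzero
    eigenvalue: [lambda2] is then an infimum over a nonempty set, bounded below
    by the smallest nonzero member of the finite family d. *)
Lemma lambda2_psd k (M : 'M[R]_k) : M^T = M ->
  (forall v, 0 <= dot v (M *m v)) -> (exists v, 0 < dot v (M *m v)) ->
  0 < lambda2 M /\
  forall v, (forall w, M *m w = 0 -> dot w v = 0) ->
    lambda2 M * dot v v <= dot v (M *m v).
Proof.
move=> Msym Mge0 [v0 Mv0].
have [d [s [dM s_ge0 sE sM s0]]] := spectral_decomposition Msym.
have d_ge0 i : 0 <= d i.
  have [u u0 Mu] := symmetric_eigenvector Msym (dM i).
  by have := Mge0 u; rewrite Mu dotZr pmulr_lge0 // dot_gt0.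
pose c := \big[Num.min/1]_(i | d i != 0) d i.
have c_gt0 : 0 < c.
  rewrite /c; apply: lt_bigmin => // i di0; by rewrite lt_def di0 d_ge0.
have lbM a : eigenvalue M a -> a != 0 -> c <= a.
  move=> /(symmetric_eigenvector Msym)[u u0 Mu] a0.
  rewrite -(ler_pM2r (dot_gt0 u0)) -(dotZr a) -Mu sM sE mulr_sumr.
  apply: ler_sum => i _; have [di0|di0] := eqVneq (d i) 0.
    rewrite s0 ?mulr0 // => w Mw; apply: (mulfI a0).
    by rewrite -dotZr -Mu dot_mulr Msym Mw mulr0 dotC dot0r.
  by apply: ler_wpM2r => //; exact: bigmin_le_cond.
have [i0 di0] : exists i, d i != 0.
  apply/not_existsP => dN; move: Mv0; rewrite sM big1 ?ltxx // => i _.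
  by have /negP := dN i; rewrite negbK => /eqP ->; rewrite mul0r.
split=> [|v vker].
  apply: lt_le_trans c_gt0 _; apply: lb_le_inf; first by exists (d i0); split.
  by move=> a [/= aM a0]; exact: lbM.
rewrite sM sE mulr_sumr; apply: ler_sum => i _.
have [di|di] := eqVneq (d i) 0; first by rewrite s0 // !mulr0.
apply: ler_wpM2r => //; apply: (ge_inf (E := [set a : R | eigenvalue M a /\ a != 0]));
  last by split.
by exists c => a [/= aM a0]; exact: lbM.
Qed.

End Spectral.

(** * Schur complement and normal equation *)

Section Schur.
Variable R : realType.

(** With w = Q12 z, the form is at least |l e + w|^2 / l + c |z|^2.  This
    controls |e| because |l e|^2 <= 2 |l e + w|^2 + 2 |w|^2 and |w|^2 <= K |z|^2:
    keeping only a fraction th of the square, the loss th K / l |z|^2 is absorbed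
    by half of c |z|^2. *)
Lemma schur_bound k (Q11 Q12 Q22 : 'M[R]_k) (l c : R) : 0 < l -> 0 < c ->
  exists2 mu, 0 < mu & forall e z : 'cV[R]_k,
    l * dot e e <= dot e (Q11 *m e) ->
    l^-1 * dot (Q12 *m z) (Q12 *m z) + c * dot z z <= dot z (Q22 *m z) ->
    mu * (dot e e + dot z z) <=
      dot e (Q11 *m e) + 2 * dot e (Q12 *m z) + dot z (Q22 *m z).
Proof.
move=> l_gt0 c_gt0; have [K K_gt0 Q12K] := mulmx_norm_bound Q12.
pose th := (1 + 2 * K / (l * c))^-1.
have D_gt0 : 0 < 1 + 2 * K / (l * c).
  by rewrite addr_gt0 // divr_gt0 ?mulr_gt0.
have th_gt0 : 0 < th by rewrite invr_gt0.
have th_le1 : th <= 1.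
  by rewrite invf_le1 // lerDl ltW // divr_gt0 ?mulr_gt0.
have thK : th * (K / l) <= c / 2.
  rewrite /th mulrC ler_pdivrMr //.
  have -> : c / 2 * (1 + 2 * K / (l * c)) = c / 2 + K / l by field; rewrite !gt_eqF.
  by rewrite lerDr divr_ge0 // ltW.
exists (Num.min (th * l / 2) (c / 2)).
  by rewrite lt_min !divr_gt0 ?mulr_gt0.
move=> e z eQ zQ; set w := Q12 *m z in zQ *.
pose s := l^-1 * dot (l *: e + w) (l *: e + w).
have sE : s = l * dot e e + 2 * dot e w + l^-1 * dot w w.
  rewrite /s !(dotDl, dotDr, dotZl, dotZr) (dotC w e); field.
  by rewrite gt_eqF.
have s_ge0 : 0 <= s by rewrite mulr_ge0 ?dot_ge0 // invr_ge0 ltW.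
have es : l / 2 * dot e e - K / l * dot z z <= s.
  have le2 := dot_le2D (l *: e + w) (- w).
  rewrite addrK !(dotZl, dotZr, dotNl, dotNr) opprK in le2.
  have wK := Q12K z; rewrite -/w in wK.
  have : l^-1 * (l * (l * dot e e)) <=
         l^-1 * (2 * dot (l *: e + w) (l *: e + w) + 2 * (K * dot z z)).
    rewrite ler_wpM2l ?invr_ge0 ?(ltW l_gt0) //; lra.
  rewrite mulKf ?gt_eqF // => ?.
  rewrite /s; lra.
have ths : th * s <= s by rewrite ler_piMl.
have thes : th * (l / 2 * dot e e - K / l * dot z z) <= th * s.
  by rewrite ler_wpM2l // ltW.
have thKz : th * (K / l) * dot z z <= c / 2 * dot z z.
  by rewrite ler_wpM2r ?dot_ge0.
have me : Num.min (th * l / 2) (c / 2) * dot e e <= th * l / 2 * dot e e.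
  by rewrite ler_wpM2r ?dot_ge0 // ge_min lexx.
have mz : Num.min (th * l / 2) (c / 2) * dot z z <= c / 2 * dot z z.
  by rewrite ler_wpM2r ?dot_ge0 // ge_min lexx orbT.
lra.
Qed.

(** A and A A^T have the same column space: if C annihilates A A^T on the right,
    then |A^T C| = 0. *)
Lemma normal_equation k l (A : 'M[R]_(k, l)) (c : 'cV[R]_l) :
  exists s, A *m (A^T *m s) = A *m c.
Proof.
have [C AAC subC] : exists2 C : 'M[R]_k, A *m A^T *m C = 0 &
    forall B : 'M[R]_(1, k), B *m C = 0 -> (B <= A *m A^T)%MS.
  exists (cokermx (A *m A^T)); first exact: mulmx_coker.
  by move=> B BC; rewrite submxE BC.
have AC0 : A^T *m C = 0.
  apply/matrixP => i j.
  have : dot (col j (A^T *m C)) (col j (A^T *m C)) = 0.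
    rewrite !colE -!mulmxA dot_mulr trmxK !mulmxA AAC.
    by rewrite !mul0mx dotC dot0r.
  by move=> /dot_eq0/colP/(_ i); rewrite !mxE.
have /submxP [D DE] : (c^T *m A^T <= A *m A^T)%MS.
  by apply: subC; rewrite -mulmxA AC0 mulmx0.
exists D^T; apply: trmx_inj.
by rewrite !trmx_mul !trmxK -mulmxA -DE.
Qed.

End Schur.

(** * Laplacian of a weight-balanced digraph *)

Section Laplacian.
Variables (R : realType) (n : nat) (G : wdigraph R n).
Hypotheses (hconn : strongly_connected G) (hbal : weight_balanced G).
Let L := laplacian G.

Lemma adj_ge0 i j : 0 <= adj G i j.
Proof.
have [/adj_edge/ltW //|/adj_nonedge ->] := boolP (edge G i j); exact: lexx.
Qed.

Lemma balance i : \sum_j adj G i j = \sum_j adj G j i.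
Proof. by have /matrixP/(_ i i) := hbal; rewrite !mxE eqxx !mulr1n. Qed.

Lemma laplacian_mul (u : 'cV[R]_n) i :
  (L *m u) i 0 = \sum_j adj G i j * (u i 0 - u j 0).
Proof.
rewrite mulmxBl !mxE.
transitivity ((\sum_j adj G j i) * u i 0 - \sum_j adj G i j * u j 0).
  congr (_ - _); rewrite (bigD1 i) //= big1 ?addr0.
    by rewrite !mxE eqxx mulr1n.
  by move=> j ji; rewrite !mxE eq_sym (negbTE ji) mulr0n mul0r.
rewrite -balance mulr_suml -sumrB; apply: eq_bigr => j _.
by rewrite mulrBr.
Qed.

(** Weight balance is what makes the two sums of squares, over tails and over
    heads of the edges, equal. *)
Lemma laplacian_form (u : 'cV[R]_n) :
  dot u (L *m u) = 2^-1 * \sum_i \sum_j adj G i j * (u i 0 - u j 0) ^+ 2.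
Proof.
have swap : \sum_i \sum_j adj G i j * u j 0 ^+ 2 =
    \sum_i \sum_j adj G i j * u i 0 ^+ 2.
  rewrite exchange_big; apply: eq_bigr => i _ /=.
  by rewrite -!mulr_suml balance.
have -> : \sum_i \sum_j adj G i j * (u i 0 - u j 0) ^+ 2 =
    2 * dot u (L *m u) +
    (\sum_i \sum_j adj G i j * u j 0 ^+ 2 - \sum_i \sum_j adj G i j * u i 0 ^+ 2).
  rewrite /dot mulr_sumr -sumrB -big_split /=; apply: eq_bigr => i _.
  rewrite laplacian_mul !mulr_sumr -sumrB -big_split /=; apply: eq_bigr => j _.
  by ring.
by rewrite swap; field.
Qed.

Lemma laplacian_ge0 (u : 'cV[R]_n) : 0 <= dot u (L *m u).
Proof.
rewrite laplacian_form mulr_ge0 ?invr_ge0 ?ler0n // sumr_ge0 // => i _.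
by rewrite sumr_ge0 // => j _; rewrite mulr_ge0 ?adj_ge0 ?sqr_ge0.
Qed.

(** By [laplacian_form], u takes equal values at the ends of each edge, hence
    along each directed path. *)
Lemma laplacian_form0 (u : 'cV[R]_n) : dot u (L *m u) = 0 ->
  forall i j, u i 0 = u j 0.
Proof.
move=> u0.
have edge_eq i j : edge G i j -> u i 0 = u j 0.
  move=> ij; apply/eqP; rewrite -subr_eq0.
  have t_ge0 k l : 0 <= adj G k l * (u k 0 - u l 0) ^+ 2.
    by rewrite mulr_ge0 ?adj_ge0 ?sqr_ge0.
  have /eqP : 2^-1 * \sum_i \sum_j adj G i j * (u i 0 - u j 0) ^+ 2 = 0.
    by rewrite -laplacian_form.
  rewrite mulf_eq0 invr_eq0 pnatr_eq0 /= psumr_eq0; last first.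
    by move=> k _; rewrite sumr_ge0.
  move=> /allP/(_ i (mem_index_enum _)) /=.
  rewrite psumr_eq0; last by move=> k _.
  move=> /allP/(_ j (mem_index_enum _)) /=.
  by rewrite mulf_eq0 expf_eq0 /= gt_eqF ?adj_edge.
move=> i j; have [->//|ij] := eqVneq i j.
have /connectP [p] := hconn ij; elim: p i {ij} => [i _ -> //|k p IHp i /=].
by move=> /andP[/edge_eq -> kp] /(IHp _ kp).
Qed.

Lemma laplacian_ones : L *m ones R n = 0.
Proof.
apply/colP => i; rewrite laplacian_mul [RHS]mxE big1 // => j _.
by rewrite !mxE subrr mulr0.
Qed.

Lemma ones_laplacian : (ones R n)^T *m L = 0.
Proof.
apply/rowP => j; rewrite !mxE (eq_bigr (fun i => L i j)); last first.
  by move=> i _; rewrite !mxE mul1r.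
rewrite /L /laplacian (eq_bigr (fun i => Din G i j - adj G i j)); last first.
  by move=> i _; rewrite !mxE.
rewrite sumrB (bigD1 j) //= big1 ?addr0; last first.
  by move=> i ij; rewrite !mxE (negbTE ij) mulr0n.
by rewrite !mxE eqxx mulr1n subrr.
Qed.

Lemma laplacian_sym_form (u : 'cV[R]_n) :
  dot u ((L + L^T) *m u) = 2 * dot u (L *m u).
Proof.
by rewrite mulmxDl dotDr (dot_mulr L^T) trmxK (dotC (L *m u)) mulr_natl mulr2n.
Qed.

(** The kernel of L + L^T consists of constant vectors, so zero-sum vectors are
    orthogonal to it.  Two distinct nodes are needed for L + L^T to be nonzero. *)
Lemma laplacian_gap : (2 <= n)%N ->
  0 < lambda2 (L + L^T) /\
  forall u : 'cV[R]_n, \sum_i u i 0 = 0 ->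
    lambda2 (L + L^T) / 2 * dot u u <= dot u (L *m u).
Proof.
move=> hn; have [] := @lambda2_psd R n (L + L^T).
- by rewrite linearD /= trmxK addrC.
- by move=> v; rewrite laplacian_sym_form mulr_ge0 ?laplacian_ge0.
- pose i0 := Ordinal (ltnW hn); pose i1 := Ordinal hn.
  exists (delta_mx i0 0); rewrite laplacian_sym_form mulr_gt0 //.
  rewrite lt_def laplacian_ge0 andbT; apply/eqP => /laplacian_form0/(_ i0 i1)/eqP.
  by rewrite !mxE !eqxx /= oner_eq0.
move=> l_gt0 gap; split=> // u u0.
have : lambda2 (L + L^T) * dot u u <= 2 * dot u (L *m u).
  rewrite -laplacian_sym_form; apply: gap => w Lw.
  have /laplacian_form0 wE : dot w (L *m w) = 0.
    apply: (@mulfI _ 2); first by rewrite pnatr_eq0.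
    by rewrite -laplacian_sym_form Lw dot0r mulr0.
  rewrite /dot (eq_bigr (fun i => w (Ordinal (ltnW hn)) 0 * u i 0)).
    by rewrite -mulr_sumr u0 mulr0.
  by move=> i _; rewrite (wE i (Ordinal (ltnW hn))).
by move=> H; rewrite mulrAC ler_pdivrMr // [X in _ <= X]mulrC.
Qed.

End Laplacian.

(** * Block vectors and Kronecker products *)

Section Kronecker.
Variables (R : realType) (n m : nat).
Implicit Types (z w : 'cV[R]_(n * m)) (v : 'cV[R]_m).

Lemma sum_mxtens (F : 'I_(n * m) -> R) :
  \sum_p F p = \sum_i \sum_k F (mxtens_index (i, k)).
Proof.
rewrite pair_big (reindex (@mxtens_index n m)) /=.
  by apply: eq_bigr => -[i k].
exact/onW_bij/(Bijective (@mxtens_indexK n m) (@mxtens_unindexK n m)).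
Qed.

(** The coordinates at position k of all blocks; on each slice, L (x) I acts as
    L does. *)
Definition slice z (k : 'I_m) : 'cV[R]_n := \col_i z (mxtens_index (i, k)) 0.

Lemma slice_dot z w : dot z w = \sum_k dot (slice z k) (slice w k).
Proof.
rewrite /dot sum_mxtens exchange_big; apply: eq_bigr => k _.
by apply: eq_bigr => i _; rewrite !mxE.
Qed.

Lemma slice_tens (M : 'M[R]_n) z k :
  slice ((M *t (1%:M : 'M[R]_m)) *m z) k = M *m slice z k.
Proof.
apply/colP => i; rewrite !mxE sum_mxtens; apply: eq_bigr => j _.
rewrite (bigD1 k) //= big1 => [|l lk].
  by rewrite addr0 tensmxE !mxE eqxx mulr1.
by rewrite tensmxE !mxE eq_sym (negbTE lk) mulr0 mul0r.
Qed.

Lemma slice_const (i0 : 'I_n) z :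
  (forall k i j, slice z k i 0 = slice z k j 0) -> exists v, z = ones R n *t v.
Proof.
move=> zc; exists (\col_k slice z k i0 0).
apply/matrixP => p q; case: (mxtens_indexP p) => i k.
rewrite [RHS]mxE !mxtens_indexK /= !mxE mul1r (ord1 q).
by have := zc k i i0; rewrite !mxE.
Qed.

Let U : 'M[R]_(n * m, 1 * m) := ones R n *t (1%:M : 'M[R]_m).

(** The columns of U are indexed by 'I_(1 * m), so v must be transported there
    by a tensor product with the 1 x 1 identity. *)
Lemma tens_ones v : ones R n *t v = U *m ((1%:M : 'M[R]_1) *t v).
Proof. by rewrite /U (tensmx_mul (ones R n)) mulmx1 mul1mx. Qed.

Lemma ones_tr_ones : (ones R n)^T *m ones R n = n%:R%:M.
Proof.
apply/matrixP => i j; rewrite !ord1 !mxE eqxx mulr1n.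
by rewrite (eq_bigr (fun=> 1)) => [|k _]; rewrite ?sumr_const ?card_ord // !mxE mulr1.
Qed.

Lemma U_tr_U : U^T *m U = n%:R%:M.
Proof.
rewrite /U trmx_tens tensmx_mul ones_tr_ones trmx1 mulmx1.
apply/matrixP => p q; case: (mxtens_indexP p) (mxtens_indexP q) => i k [j l].
rewrite tensmxE !mxE (can_eq (@mxtens_indexK _ _)) !ord1 xpair_eqE eqxx.
by rewrite mulr1n mulr_natr.
Qed.

Lemma stack_mulU (b : 'I_n -> 'cV[R]_m) :
  U^T *m stack b = (1%:M : 'M[R]_1) *t (\sum_i b i).
Proof.
apply/matrixP => p q; case: (mxtens_indexP p) => i k.
rewrite mxE sum_mxtens [RHS]mxE !mxtens_indexK !ord1 /= mxE eqxx mul1r.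
rewrite summxE; apply: eq_bigr => j _; rewrite (bigD1 k) //= big1 => [|l lk].
  by rewrite addr0 mxE tensmxE !mxE mxtens_indexK eqxx !mul1r.
by rewrite mxE tensmxE !mxE (negbTE lk) mulr0 mul0r.
Qed.

Lemma blkdiag_ones (A : 'I_n -> 'M[R]_m) v :
  blkdiag A *m (ones R n *t v) = stack (fun i => A i *m v).
Proof.
apply/matrixP => p q; case: (mxtens_indexP p) => i k.
rewrite mxE sum_mxtens [RHS]mxE mxtens_indexK mxE (bigD1 i) //= [X in _ + X]big1 => [|j ji].
  rewrite addr0; apply: eq_bigr => l _.
  by rewrite mxE !mxtens_indexK eqxx mxE !mxtens_indexK mxE mul1r !ord1.
by apply: big1 => l _; rewrite mxE !mxtens_indexK eq_sym (negbTE ji) mul0r.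
Qed.

Lemma slice_sum0 z k : U^T *m z = 0 -> \sum_i slice z k i 0 = 0.
Proof.
move=> /matrixP/(_ (mxtens_index (0, k)) 0); rewrite [RHS]mxE => Uz; rewrite -[RHS]Uz.
rewrite [RHS]mxE sum_mxtens; apply: eq_bigr => i _.
rewrite (bigD1 k) //= big1 => [|l lk].
  by rewrite addr0 !mxE !mxtens_indexK /= eqxx !mul1r.
by rewrite mxE tensmxE !mxE (negbTE lk) mulr0 mul0r.
Qed.

Definition block_sum z : 'cV[R]_m := \col_k \sum_i slice z k i 0.

Lemma dot_tens_ones v z : dot (ones R n *t v : 'cV[R]_(n * m)) z = dot v (block_sum z).
Proof.
rewrite slice_dot; apply: eq_bigr => k _.
rewrite mxE mulr_sumr; apply: eq_bigr => i _; congr (_ * _).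
by rewrite !mxE mxtens_indexK !ord1 mul1r.
Qed.

Lemma block_sum_tens_ones v :
  block_sum (ones R n *t v : 'cV[R]_(n * m)) = n%:R *: v.
Proof.
apply/colP => k; rewrite !mxE (eq_bigr (fun=> v k 0)).
  by rewrite sumr_const card_ord mulr_natl.
by move=> i _; rewrite !mxE mxtens_indexK !ord1 mul1r.
Qed.

End Kronecker.

Section KroneckerLaplacian.
Variables (R : realType) (n m : nat) (G : wdigraph R n).
Hypotheses (hconn : strongly_connected G) (hbal : weight_balanced G).
Let L := laplacian G.
Let bL : 'M[R]_(n * m) := L *t (1%:M : 'M[R]_m).
Let U : 'M[R]_(n * m, 1 * m) := ones R n *t (1%:M : 'M[R]_m).

Lemma kron_form z : dot z (bL *m z) = \sum_k dot (slice z k) (L *m slice z k).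
Proof. by rewrite slice_dot; apply: eq_bigr => k _; rewrite slice_tens. Qed.

Lemma kron_form_ge0 z : 0 <= dot z (bL *m z).
Proof. by rewrite kron_form; apply: sumr_ge0 => k _; exact: laplacian_ge0. Qed.

Lemma kron_form0 (i0 : 'I_n) z : dot z (bL *m z) = 0 ->
  exists v : 'cV[R]_m, z = ones R n *t v.
Proof.
rewrite kron_form => /psumr_eq0P z0; apply: (slice_const i0) => k.
by apply: (laplacian_form0 hconn hbal); apply: z0 => // l _; exact: laplacian_ge0.
Qed.

Lemma kron_gap z : (2 <= n)%N -> U^T *m z = 0 ->
  lambda2 (L + L^T) / 2 * dot z z <= dot z (bL *m z).
Proof.
move=> hn Uz; have [_ gap] := laplacian_gap hconn hbal hn.
rewrite kron_form slice_dot mulr_sumr; apply: ler_sum => k _.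
by apply: gap; exact: slice_sum0.
Qed.

Lemma kron_form_gt0 : (2 <= n)%N -> (0 < m)%N -> exists z, 0 < dot z (bL *m z).
Proof.
move=> hn hm; pose i0 := Ordinal (ltnW hn); pose i1 := Ordinal hn.
pose k0 := Ordinal hm; pose p := mxtens_index (i0, k0).
exists (delta_mx p 0); rewrite lt_def kron_form_ge0 andbT; apply/eqP.
move=> /(kron_form0 i0)[v /matrixP dv].
have := dv p 0; rewrite -[RHS](_ : (ones R n *t v) (mxtens_index (i1, k0)) 0 = _).
  rewrite -dv !mxE !eqxx (can_eq (@mxtens_indexK _ _)) xpair_eqE /= => /eqP.
  by rewrite oner_eq0.
by rewrite !mxE !mxtens_indexK /=.
Qed.

Lemma kron_mulU : bL *m U = 0.
Proof. by rewrite /bL /U tensmx_mul laplacian_ones // tens0mx. Qed.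

Lemma kron_trU : U^T *m bL = 0.
Proof. by rewrite /bL /U trmx_tens tensmx_mul ones_laplacian // tens0mx. Qed.

End KroneckerLaplacian.

(** * Differential inequalities on the half-line *)

Section Analysis.
Variable R : realType.
Implicit Types (f g df dg : R -> R).

(** Scalar counterpart of [has_derivative]. *)
Definition deriv_on_pos f df :=
  {within [set t : R | 0 <= t], continuous f} /\
  (forall t : R, 0 < t -> is_derive t (1 : R) f (df t)).

Lemma deriv_on_posD f df g dg : deriv_on_pos f df -> deriv_on_pos g dg ->
  deriv_on_pos (fun t => f t + g t) (fun t => df t + dg t).
Proof.
move=> [fc fd] [gc gd]; split.
  by move=> t; apply: cvgD; [exact: fc | exact: gc].
by move=> t t0; have := fd t t0; have := gd t t0 => ? ?; exact: is_deriveD.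
Qed.

Lemma deriv_on_posM f df g dg : deriv_on_pos f df -> deriv_on_pos g dg ->
  deriv_on_pos (fun t => f t * g t) (fun t => f t * dg t + g t * df t).
Proof.
move=> [fc fd] [gc gd]; split.
  by move=> t; apply: cvgM; [exact: fc | exact: gc].
by move=> t t0; have := fd t t0; have := gd t t0 => ? ?; exact: is_deriveM.
Qed.

Lemma deriv_on_pos_cst (a : R) : deriv_on_pos (fun=> a) (fun=> 0).
Proof.
by split=> [|t _]; [exact: cst_continuous | exact: is_derive_cst].
Qed.

Lemma deriv_on_pos_sum k (F dF : 'I_k -> R -> R) :
  (forall i, deriv_on_pos (F i) (dF i)) ->
  deriv_on_pos (fun t => \sum_i F i t) (fun t => \sum_i dF i t).
Proof.
move=> Fd.
have Sd (r : seq 'I_k) :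
    deriv_on_pos (fun t => \sum_(i <- r) F i t) (fun t => \sum_(i <- r) dF i t).
  elim: r => [|i r IHr].
    have -> : (fun t => \sum_(i <- [::]) F i t) = fun=> 0.
      by apply/funext => t; rewrite big_nil.
    have -> : (fun t => \sum_(i <- [::]) dF i t) = fun=> 0.
      by apply/funext => t; rewrite big_nil.
    exact: deriv_on_pos_cst.
  have -> : (fun t => \sum_(j <- i :: r) F j t) =
      fun t => F i t + \sum_(j <- r) F j t by apply/funext => t; rewrite big_cons.
  have -> : (fun t => \sum_(j <- i :: r) dF j t) =
      fun t => dF i t + \sum_(j <- r) dF j t by apply/funext => t; rewrite big_cons.
  exact: deriv_on_posD.
exact: Sd.
Qed.

(** The function f t * exp (k t) has nonpositive derivative on the open
    half-line and is continuous up to 0, so the mean value theorem applies. *)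
Lemma gronwall f df (k : R) : deriv_on_pos f df ->
  (forall t, 0 < t -> df t <= - k * f t) ->
  forall t, 0 <= t -> f t <= f 0 * expR (- (k * t)).
Proof.
move=> fd dfle t t0.
have ed : deriv_on_pos (fun t => expR (k * t)) (fun t => k * expR (k * t)).
  have ed' u : is_derive u (1 : R) (fun t => expR (k * t)) (k * expR (k * u)).
    have kd : is_derive u (1 : R) (fun t => k * t) k.
      have := is_deriveZ k (is_derive_id u (1 : R)).
      by rewrite /GRing.scale /= mulr1.
    by have := is_derive1_comp (is_derive_expR (k * u)) kd; rewrite mulrC.
  split=> [|u _]; last exact: ed'.
  apply: continuous_subspaceT => u.
  by apply: differentiable_continuous; apply/derivable1_diffP; case: (ed' u).
have [gc gd] := deriv_on_posM fd ed.
have [->|tN0] := eqVneq t 0; first by rewrite mulr0 oppr0 expR0 mulr1.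
have t_gt0 : 0 < t by rewrite lt_def tN0.
have itvd u : u \in `]0, t[%R -> is_derive u (1 : R) (fun t => f t * expR (k * t))
    (f u * (k * expR (k * u)) + expR (k * u) * df u).
  by rewrite in_itv /= => /andP[u0 _]; exact: gd.
have [|c] := MVT t_gt0 itvd.
  by apply: continuous_subspaceW gc => u /=; rewrite in_itv /= => /andP[].
rewrite in_itv /= => /andP[c0 _] gt.
rewrite expRN ler_pdivlMr ?expR_gt0 //.
have -> : f 0 = f 0 * expR (k * 0) by rewrite mulr0 expR0 mulr1.
rewrite -subr_le0 gt pmulr_lle0 ?subr_gt0 //.
have -> : f c * (k * expR (k * c)) + expR (k * c) * df c =
  expR (k * c) * (df c - (- k * f c)) by ring.
by rewrite pmulr_rle0 ?expR_gt0 // subr_le0 dfle.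
Qed.

Lemma deriv_on_pos0_cst f : deriv_on_pos f (fun=> 0) ->
  forall t, 0 <= t -> f t = f 0.
Proof.
move=> fd t t0; apply/eqP; rewrite eq_le.
have half g : deriv_on_pos g (fun=> 0) -> g t <= g 0.
  move=> gd; have := gronwall (k := 0) gd _ t0.
  by rewrite mul0r oppr0 expR0 mulr1; apply => u _; rewrite mul0r.
rewrite half //=.
have Nfd := deriv_on_posM (deriv_on_pos_cst (-1)) fd.
rewrite -lerN2 -(mulN1r (f 0)) -(mulN1r (f t)); apply: (half (fun t => -1 * f t)).
suff <- : (fun t => -1 * 0 + f t * 0) = (fun=> 0 : R) by [].
by apply/funext => u; rewrite !mulr0 addr0.
Qed.

Definition vderiv k (z v : R -> 'cV[R]_k) :=
  forall i, deriv_on_pos (fun t => z t i 0) (fun t => v t i 0).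

Lemma has_derivative_vderiv k (z v : R -> 'cV[R]_k) :
  has_derivative z v -> vderiv z v.
Proof.
move=> [zc zd] i; split.
  apply: (@within_continuous_comp _ _ _ _ z (fun w : 'cV[R]_k => w i 0)) => //.
  by move=> w _; exact: coord_continuous.
move=> t t0; have [dz <-] := zd t t0; rewrite derive_mx // mxE.
by apply: derivableP; move/derivable_mxP : dz.
Qed.

Lemma vderivD k (z v z' v' : R -> 'cV[R]_k) : vderiv z v -> vderiv z' v' ->
  vderiv (fun t => z t + z' t) (fun t => v t + v' t).
Proof.
move=> zv zv' i; have := deriv_on_posD (zv i) (zv' i).
by congr deriv_on_pos; apply/funext => t; rewrite mxE.
Qed.

Lemma vderiv_cst k (c : 'cV[R]_k) : vderiv (fun=> c) (fun=> 0).
Proof.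
by move=> i; have := deriv_on_pos_cst (c i 0); congr deriv_on_pos;
   apply/funext => t; rewrite mxE.
Qed.

Lemma vderiv_mulmx k l (C : 'M[R]_(k, l)) (z v : R -> 'cV[R]_l) : vderiv z v ->
  vderiv (fun t => C *m z t) (fun t => C *m v t).
Proof.
move=> zv i.
have := deriv_on_pos_sum (fun j => deriv_on_posM (deriv_on_pos_cst (C i j)) (zv j)).
congr deriv_on_pos; apply/funext => t; rewrite mxE //.
by apply: eq_bigr => j _; rewrite mulr0 addr0.
Qed.

Lemma vderiv_dot k (z v : R -> 'cV[R]_k) : vderiv z v ->
  deriv_on_pos (fun t => dot (z t) (z t)) (fun t => 2 * dot (z t) (v t)).
Proof.
move=> zv; have := deriv_on_pos_sum (fun i => deriv_on_posM (zv i) (zv i)).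
congr deriv_on_pos; apply/funext => t.
by rewrite mulr_sumr; apply: eq_bigr => i _; rewrite mulr_natl mulr2n.
Qed.

Lemma vderiv0_cst k (z : R -> 'cV[R]_k) : vderiv z (fun=> 0) ->
  forall t, 0 <= t -> z t = z 0.
Proof.
move=> zv t t0; apply/colP => i.
apply: (@deriv_on_pos0_cst (fun t => z t i 0)) => //.
by have := zv i; congr deriv_on_pos; apply/funext => u; rewrite mxE.
Qed.

End Analysis.

(** * The closed-loop system *)

(** The average part U U^T bA e / n of y is what produces the term
    beta bA^T U U^T bA of Q11 and the last term of Q12; it is invisible to bL
    since bL U = 0. *)
Lemma lyapunov_derivative (R : realType) N p (bL bA : 'M[R]_N) (U : 'M[R]_(N, p))
    (c alpha beta gamma : R) (e z y : 'cV[R]_N) :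
  c != 0 -> bL *m U = 0 -> y = z + c^-1 *: (U *m (U^T *m (bA *m e))) ->
  let Q11 := (alpha / 2) *: (bL + bL^T) + beta *: (bA^T *m U *m U^T *m bA) in
  let Q12 := 2^-1 *: ((c * beta) *: bA^T + alpha *: (bL^T *m bA^T)
                      + beta *: (bA^T *m U *m U^T *m bA *m bA^T)) in
  let Q22 := (c * beta) *: (bA *m bA^T) + gamma *: bL in
  dot e (- (alpha *: (bL *m e)) - (c * beta) *: (bA^T *m y)) +
  dot z (- (alpha *: (bA *m bL *m e)) - (c * beta) *: (bA *m bA^T *m y)
         - gamma *: (bL *m y)) =
  - (dot e (Q11 *m e) + 2 * dot e (Q12 *m z) + dot z (Q22 *m z)).
Proof.
move=> c0 LU -> Q11 Q12 Q22; rewrite /Q11 /Q12 /Q22.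
have LUU v : bL *m (U *m v) = 0 by rewrite mulmxA LU mul0mx.
rewrite !(mulmxDl, mulmxDr, mulmxBl) -!(scalemxAl, scalemxAr) -!mulmxA.
rewrite !(mulmxDl, mulmxDr, mulmxBl) -!(scalemxAl, scalemxAr) -!mulmxA LUU scaler0.
rewrite !(dotDr, dotNr, dotZr, dot0r).
have -> : dot e (bL^T *m e) = dot e (bL *m e) by rewrite dot_mulr trmxK dotC.
have -> : dot e (bL^T *m (bA^T *m z)) = dot z (bA *m (bL *m e)).
  by rewrite (dot_mulr bL^T) (dot_mulr bA^T) !trmxK dotC.
have -> : dot e (bA^T *m (U *m (U^T *m (bA *m (bA^T *m z))))) =
    dot z (bA *m (bA^T *m (U *m (U^T *m (bA *m e))))).
  rewrite (dot_mulr bA^T) (dot_mulr U) (dot_mulr U^T) (dot_mulr bA).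
  by rewrite (dot_mulr bA^T) !trmxK dotC.
by field.
Qed.

(** Starting from any solution, subtract from the average of the blocks of x0 a
    vector in the range of A^T, which is orthogonal to null(A); the normal
    equation says that a solution of A x = b can be reached in this way. *)
Lemma limit_exists (R : realType) n m (A_ : 'I_n -> 'M[R]_m) (b_ : 'I_n -> 'cV[R]_m)
    (x0 : 'cV[R]_(n * m)) : (0 < n)%N ->
  (exists x : 'cV[R]_m, (\sum_i A_ i) *m x = \sum_i b_ i) ->
  exists2 xstar : 'cV[R]_m, (\sum_i A_ i) *m xstar = \sum_i b_ i &
    forall v : 'cV[R]_m, (\sum_i A_ i) *m v = 0 ->
      dot (ones R n *t v : 'cV[R]_(n * m)) (x0 - (ones R n *t xstar : 'cV[R]_(n * m))) = 0.
Proof.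
move=> n_gt0 [xp Axp]; set A := \sum_i A_ i in Axp *.
have n0 : n%:R != 0 :> R by rewrite pnatr_eq0 -lt0n.
have [s As] := normal_equation A (n%:R^-1 *: block_sum x0 - xp).
exists (n%:R^-1 *: block_sum x0 - A^T *m s) => [|v Av].
  by rewrite mulmxBr As mulmxBr subKr.
rewrite dotDr dotNr !dot_tens_ones block_sum_tens_ones -dotNr -dotDr.
rewrite scalerBr scalerA divff // scale1r subKr dotZr dot_mulr trmxK Av.
by rewrite dotC dot0r mulr0.
Qed.

Lemma gram_sub_sym (R : realType) k (a b : R) (P Q : 'M[R]_k) :
  (a *: (P^T *m P) - b *: (Q *m Q^T))^T = a *: (P^T *m P) - b *: (Q *m Q^T).
Proof. by rewrite linearB /= !linearZ /= !trmx_mul !trmxK. Qed.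

Lemma gram_sub_form (R : realType) k (a b : R) (P Q : 'M[R]_k) z :
  dot z ((a *: (P^T *m P) - b *: (Q *m Q^T)) *m z) =
  a * dot (P *m z) (P *m z) - b * dot z (Q *m Q^T *m z).
Proof.
rewrite mulmxBl -!scalemxAl dotDr dotNr !dotZr -(mulmxA P^T).
by rewrite (dot_mulr P^T) trmxK.
Qed.

Section ClosedLoop.
Variables (R : realType) (n m : nat) (hn : (2 <= n)%N) (hm : (0 < m)%N).
Variables (G : wdigraph R n) (hconn : strongly_connected G) (hbal : weight_balanced G).
Variable (A_ : 'I_n -> 'M[R]_m).
Variables (alpha beta : R) (halpha : 0 < alpha) (hbeta : 0 < beta).

Let L := laplacian G.
Let bL : 'M[R]_(n * m) := L *t (1%:M : 'M[R]_m).
Let bA := blkdiag A_.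
Let U : 'M[R]_(n * m, 1 * m) := ones R n *t (1%:M : 'M[R]_m).
Let Q11 := (alpha / 2) *: (bL + bL^T) + beta *: (bA^T *m U *m U^T *m bA).
Let Q12 := 2^-1 *: ((n%:R * beta) *: bA^T + alpha *: (bL^T *m bA^T)
                    + beta *: (bA^T *m U *m U^T *m bA *m bA^T)).

Lemma Q11_form e : dot e (Q11 *m e) =
  alpha * dot e (bL *m e) + beta * dot (U^T *m (bA *m e)) (U^T *m (bA *m e)).
Proof.
rewrite /Q11 !mulmxDl -!scalemxAl mulmxDl !(dotDr, dotZr).
rewrite (dot_mulr bL^T) trmxK (dotC (bL *m e)) -!mulmxA.
by rewrite (dot_mulr bA^T) (dot_mulr U) !trmxK; field.
Qed.

Lemma Q11_sym : Q11^T = Q11.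
Proof.
rewrite /Q11 linearD /= !linearZ /= linearD /= !trmx_mul !trmxK !mulmxA.
by rewrite (addrC bL^T).
Qed.

Lemma Q11_ge0 e : 0 <= dot e (Q11 *m e).
Proof.
rewrite Q11_form addr_ge0 // mulr_ge0 ?dot_ge0 ?(ltW halpha) ?(ltW hbeta) //.
exact: kron_form_ge0.
Qed.

Lemma U_blkdiag_ones (v : 'cV[R]_m) :
  U^T *m (bA *m (ones R n *t v)) = (1%:M : 'M[R]_1) *t ((\sum_i A_ i) *m v).
Proof. by rewrite blkdiag_ones stack_mulU mulmx_suml. Qed.

Lemma tens1_eq0 (v : 'cV[R]_m) : (1%:M : 'M[R]_1) *t v = 0 -> v = 0.
Proof.
move=> /matrixP v0; apply/colP => k.
by have := v0 (mxtens_index (0, k)) 0; rewrite !mxE mxtens_indexK /= !ord1 mul1r.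
Qed.

(** Both terms of [Q11_form] vanish: the first makes w a vector with equal blocks
    v, the second reads (sum_i A_i) v = 0. *)
Lemma Q11_ker (w : 'cV[R]_(n * m)) : Q11 *m w = 0 ->
  exists2 v : 'cV[R]_m, w = ones R n *t v & (\sum_i A_ i) *m v = 0.
Proof.
move=> Qw; have : dot w (Q11 *m w) = 0 by rewrite Qw dot0r.
rewrite Q11_form => /eqP.
have Lw := kron_form_ge0 hbal w; have Aw := dot_ge0 (U^T *m (bA *m w)).
rewrite paddr_eq0 ?mulr_ge0 ?(ltW halpha) ?(ltW hbeta) //.
rewrite !mulf_eq0 (gt_eqF halpha) (gt_eqF hbeta) /=.
move=> /andP[/eqP /(kron_form0 hconn hbal (Ordinal hn))[v ->]] /eqP /dot_eq0; exists v => //.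
by apply: tens1_eq0; rewrite -U_blkdiag_ones.
Qed.

Lemma lambda2_Q11 : 0 < lambda2 Q11 /\
  forall e, (forall w, Q11 *m w = 0 -> dot w e = 0) ->
    lambda2 Q11 * dot e e <= dot e (Q11 *m e).
Proof.
apply: lambda2_psd; [exact: Q11_sym | exact: Q11_ge0 |].
have [e Le] := kron_form_gt0 hconn hbal hn hm; exists e.
by rewrite Q11_form ltr_pwDl ?mulr_gt0 // mulr_ge0 ?dot_ge0 // ltW.
Qed.

(** Completing the square leaves the Schur complement, which on z orthogonal to
    the columns of U is at least
    gamma lambda2(L + L^T) / 2 - lambda_max(M); the bound on gamma says exactly
    that this constant and gamma are positive. *)
Lemma dissipation (gamma : R) :
  Num.max (2 / lambda2 (L + L^T)
           * lambda_max ((lambda2 Q11)^-1 *: (Q12^T *m Q12)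
                         - (n%:R * beta) *: (bA *m bA^T)))
          0 < gamma ->
  exists2 mu, 0 < mu & forall e z : 'cV[R]_(n * m),
    (forall w, Q11 *m w = 0 -> dot w e = 0) -> U^T *m z = 0 ->
    mu * (dot e e + dot z z) <= dot e (Q11 *m e) + 2 * dot e (Q12 *m z)
      + dot z (((n%:R * beta) *: (bA *m bA^T) + gamma *: bL) *m z).
Proof.
set M := (lambda2 Q11)^-1 *: _ - _; rewrite gt_max => /andP[gammaM gamma0].
have [lL_gt0 _] := laplacian_gap hconn hbal hn; rewrite -/L in lL_gt0.
have [lQ_gt0 Qgap] := lambda2_Q11.
have c_gt0 : 0 < gamma * (lambda2 (L + L^T) / 2) - lambda_max M.
  rewrite subr_gt0; rewrite -(ltr_pM2l lL_gt0) in gammaM.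
  have -> : lambda_max M = lambda2 (L + L^T) * (2 / lambda2 (L + L^T) * lambda_max M) / 2.
    by field; rewrite gt_eqF.
  by rewrite [X in _ < X]mulrA ltr_pM2r ?invr_gt0 // (mulrC gamma).
have [mu mu_gt0 bound] := schur_bound Q11 Q12
  ((n%:R * beta) *: (bA *m bA^T) + gamma *: bL) lQ_gt0 c_gt0.
exists mu => // e z eQ Uz; apply: bound; first exact: Qgap.
have Msym : M^T = M by exact: gram_sub_sym.
have := rayleigh_lambda_max z Msym.
rewrite gram_sub_form -/M.
have := kron_gap hconn hbal hn Uz; rewrite -/L -/bL => /(ler_wpM2l (ltW gamma0)).
rewrite mulmxDl -!scalemxAl dotDr !dotZr; lra.
Qed.

End ClosedLoop.

(** * Convergence *)

Theorem mainTheorem3 (R : realType) (n m : nat) (hn : (2 <= n)%N) (hm : (0 < m)%N)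
    (G : wdigraph R n) (hconn : strongly_connected G) (hbal : weight_balanced G)
    (A_ : 'I_n -> 'M[R]_m) (b_ : 'I_n -> 'cV[R]_m)
    (hsol : exists x : 'cV[R]_m, (\sum_i A_ i) *m x = \sum_i b_ i)
    (hnull : forall (i : 'I_n) (v : 'cV[R]_m),
       (\sum_j A_ j) *m v = 0 -> A_ i *m v = 0)
    (alpha beta : R) (halpha : 0 < alpha) (hbeta : 0 < beta) :
  let L := laplacian G in
  let bL := L *t (1%:M : 'M[R]_m) in
  let bA := blkdiag A_ in
  let bb := stack b_ in
  let U := ones R n *t (1%:M : 'M[R]_m) in
  let Q11 := (alpha / 2) *: (bL + bL^T) + beta *: (bA^T *m U *m U^T *m bA) in
  let Q12 := 2^-1 *: ((n%:R * beta) *: bA^T + alpha *: (bL^T *m bA^T)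
                      + beta *: (bA^T *m U *m U^T *m bA *m bA^T)) in
  let gammabar :=
    Num.max (2 / lambda2 (L + L^T)
             * lambda_max ((lambda2 Q11)^-1 *: (Q12^T *m Q12)
                           - (n%:R * beta) *: (bA *m bA^T)))
            0 in
  forall gamma : R, gammabar < gamma ->
  forall x y : R -> 'cV[R]_(n * m),
    has_derivative x (fun t =>
      - (alpha *: (bL *m x t)) - (n%:R * beta) *: (bA^T *m y t)) ->
    has_derivative y (fun t =>
      - (alpha *: (bA *m bL *m x t)) - (n%:R * beta) *: (bA *m bA^T *m y t)
      - gamma *: (bL *m y t)) ->
    U^T *m y 0 = U^T *m (bA *m x 0 - bb) ->
    exists xstar : 'cV[R]_m,
      (\sum_i A_ i) *m xstar = \sum_i b_ i /\
      converges_exponentially (fun t => col_mx (x t) (y t))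
        (col_mx (ones R n *t xstar : 'cV[R]_(n * m)) 0).
Proof.
move=> L bL bA bb U Q11 Q12 gammabar gamma hgamma x y hx hy hinit.
have [mu mu_gt0 diss] := dissipation hn hm hconn hbal halpha hbeta hgamma.
rewrite -/L -/bL -/bA -/U -/Q11 -/Q12 in diss.
have n0 : n%:R != 0 :> R by rewrite pnatr_eq0 -lt0n (ltnW hn).
have LU : bL *m U = 0 := kron_mulU m hbal.
have UL : U^T *m bL = 0 := kron_trU m G.
have UU : U^T *m U = n%:R%:M := U_tr_U R n m.
have {}hx := has_derivative_vderiv hx; have {}hy := has_derivative_vderiv hy.
have [xstar Axstar xstar_perp] := limit_exists (x 0) (ltnW hn) hsol.
exists xstar; split=> //.
pose xs : 'cV[R]_(n * m) := ones R n *t xstar.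
pose e t := x t - xs.
have Lxs : bL *m xs = 0 by rewrite /xs tens_ones mulmxA LU mul0mx.
have Uxs : U^T *m (bA *m xs) = U^T *m bb.
  by rewrite /xs blkdiag_ones /bb !stack_mulU -mulmx_suml Axstar.
have e_deriv : vderiv e (fun t => - (alpha *: (bL *m e t)) - (n%:R * beta) *: (bA^T *m y t)).
  have := vderivD hx (vderiv_cst (- xs)); congr vderiv; apply/funext => t.
  by rewrite addr0 /e mulmxBr Lxs subr0.
have {}hy : vderiv y (fun t => - (alpha *: (bA *m bL *m e t))
    - (n%:R * beta) *: (bA *m bA^T *m y t) - gamma *: (bL *m y t)).
  move: hy; congr vderiv; apply/funext => t.
  by rewrite /e -!(mulmxA bA bL) mulmxBr Lxs subr0.
(* Conservation of U^T (y - bA e), which is zero at time 0. *)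
have Uy t : 0 <= t -> U^T *m y t = U^T *m (bA *m e t).
  move=> t0.
  have drift u : - (alpha *: (bA *m bL *m e u)) - (n%:R * beta) *: (bA *m bA^T *m y u)
      - gamma *: (bL *m y u)
      - bA *m (- (alpha *: (bL *m e u)) - (n%:R * beta) *: (bA^T *m y u)) =
      - (gamma *: (bL *m y u)).
    by rewrite (mulmxBr bA) mulmxN -!scalemxAr !mulmxA addrAC subrr add0r.
  have wd : vderiv (fun t => U^T *m y t + (- (U^T *m bA)) *m e t) (fun=> 0).
    have := vderivD (vderiv_mulmx U^T hy) (vderiv_mulmx (- (U^T *m bA)) e_deriv).
    congr vderiv; apply/funext => u.
    rewrite mulNmx -(mulmxA U^T bA) -mulmxBr drift.
    by rewrite mulmxN -scalemxAr mulmxA UL mul0mx scaler0 oppr0.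
  have := vderiv0_cst wd t0.
  rewrite hinit !mulNmx -!mulmxA [in RHS]/e !mulmxBr Uxs subrr.
  by move=> /eqP; rewrite subr_eq0 => /eqP.
(* The components of e along the kernel of Q11 are constants of motion, zero by
   the choice of xstar; null(A) <= null(A_i) is used to get bA w = 0. *)
have e_perp t w : 0 <= t -> Q11 *m w = 0 -> dot w (e t) = 0.
  move=> t0 /(Q11_ker hn hconn hbal halpha hbeta)[v wE Av].
  have wL : w^T *m bL = 0.
    by rewrite wE tens_ones trmx_mul -mulmxA UL mulmx0.
  have Aw : bA *m w = 0.
    rewrite wE blkdiag_ones; apply/colP => p; rewrite !mxE.
    by case: (mxtens_unindex p) => i k; rewrite hnull // mxE.
  have wd : vderiv (fun t => w^T *m e t) (fun=> 0).
    have := vderiv_mulmx w^T e_deriv; congr vderiv; apply/funext => u.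
    rewrite (mulmxBr w^T) mulmxN -!scalemxAr !mulmxA wL mul0mx -trmx_mul Aw trmx0 mul0mx.
    by rewrite !scaler0 oppr0 addr0.
  rewrite dotE (vderiv0_cst wd t0) -dotE wE.
  exact: xstar_perp.
pose Pi : 'M[R]_(n * m) := 1%:M - n%:R^-1 *: (U *m U^T).
pose z t := Pi *m y t.
have UPi : U^T *m Pi = 0.
  rewrite mulmxBr mulmx1 -scalemxAr mulmxA UU mul_scalar_mx scalerA mulVf //.
  by rewrite scale1r subrr.
have Uz t : U^T *m z t = 0 by rewrite /z mulmxA UPi mul0mx.
have Pi_sym : Pi^T = Pi.
  by rewrite /Pi linearB /= linearZ /= trmx1 trmx_mul trmxK.
have Piz t : Pi *m z t = z t.
  by rewrite {1}/Pi mulmxBl mul1mx -scalemxAl -mulmxA Uz mulmx0 scaler0 subr0.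
have yE t : 0 <= t -> y t = z t + n%:R^-1 *: (U *m (U^T *m (bA *m e t))).
  move=> t0; rewrite -Uy // /z /Pi mulmxBl mul1mx -scalemxAl mulmxA.
  by rewrite subrK.
pose V t := dot (e t) (e t) + dot (z t) (z t).
(* V' = - 2 times the form bounded below in [diss], as Pi z = z. *)
have V_deriv := deriv_on_posD (vderiv_dot e_deriv) (vderiv_dot (vderiv_mulmx Pi hy)).
have V_decay t : 0 <= t -> V t <= V 0 * expR (- (2 * mu * t)).
  apply: (gronwall V_deriv) => u u0.
  rewrite dot_mulr Pi_sym Piz -mulrDr.
  rewrite (lyapunov_derivative alpha beta gamma n0 LU (yE u (ltW u0))).
  rewrite -/Q11 -/Q12.
  have := diss (e u) (z u) (fun w => e_perp u w (ltW u0)) (Uz u).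
  rewrite /V; lra.
have [K K_gt0 yK] := mulmx_norm_bound (n%:R^-1 *: (U *m U^T *m bA)).
have y_le t : 0 <= t -> dot (y t) (y t) <= 2 * dot (z t) (z t) + 2 * (K * dot (e t) (e t)).
  move=> t0; rewrite yE //; apply: le_trans (dot_le2D _ _) _.
  rewrite lerD2l ler_pM2l // !mulmxA scalemxAl; exact: yK.
exists (Num.sqrt ((3 + 2 * K) * V 0) + 1), mu; split => //.
move=> t t0.
have V0 : 0 <= V 0 by rewrite addr_ge0 ?dot_ge0.
rewrite enorm_dot opp_col_mx add_col_mx subr0 dot_col_mx -/xs -/(e t).
apply: (@le_trans _ _ (Num.sqrt ((3 + 2 * K) * V 0) * expR (- (mu * t)))); last first.
  by rewrite ler_wpM2r ?expR_ge0 // lerDl.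
have -> : expR (- (mu * t)) = Num.sqrt (expR (- (2 * mu * t))).
  have -> : expR (- (2 * mu * t)) = expR (- (mu * t)) ^+ 2.
    by rewrite expr2 -expRD; congr expR; ring.
  by rewrite sqrtr_sqr ger0_norm ?expR_ge0.
have K3 : 0 <= 3 + 2 * K by rewrite addr_ge0 // mulr_ge0 // ltW.
rewrite -sqrtrM ?mulr_ge0 // ler_wsqrtr // -(mulrA (3 + 2 * K)).
apply: (@le_trans _ _ ((3 + 2 * K) * V t)); last first.
  by rewrite ler_wpM2l // V_decay.
have := y_le t t0; have := dot_ge0 (e t); have := dot_ge0 (z t).
have : 0 <= K * dot (z t) (z t) by rewrite mulr_ge0 ?dot_ge0 // ltW.
rewrite /V; lra.
Qed.
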